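(* Let $d\ge2$, let $\mathbf{T}\in\mathbb{N}^{n_1\times\dots\times n_d}$ be a nonzero contingency table and let $\mathbf{F}=\mathbf{T}/\sum_{i_1,\dots,i_d}T_{i_1\dots i_d}$ be its frequency tensor. For $\mu\in\{1,\dots,d\}$ let $\mathbf{f}^\mu\in\mathbb{R}^{n_\mu}$ be the mode-$\mu$ marginal of $\mathbf{F}$, assumed to have no zero component, and let $D_\mu=\operatorname{diag}(\sqrt{\mathbf{f}^\mu})$. View $\mathbf{F}$ as an element of the space $\mathcal{S}_M=\mathbb{R}^{n_1\times\dots\times n_d}$ endowed with the inner product induced by the matrices $D_1^{-1},\dots,D_d^{-1}$, and let $Z_\mu\in\mathbb{R}^{n_\mu\times r_\mu}$ be the scaled principal components of mode $\mu$ of $\mathbf{F}$ in $\mathcal{S}_M$ at multilinear rank $(r_1,\dots,r_d)$, with $\mathbf{z}^\mu_{i_\mu}$ denoting the $i_\mu$-th row of $Z_\mu$. If $r_\mu=\operatorname{rank}(F^{(\mu)})$ for every $\mu\in\{1,\dots,d\}$, then for every $\mu\in\{1,\dots,d\}$, $i_\mu\in\{1,\dots,n_\mu\}$ and $\ell_\mu\in\{1,\dots,r_\mu\}$, $$(z^\mu_{i_\mu})_{\ell_\mu}=\frac{1}{\sigma^\mu_{\ell_\mu}}\sum_{\substack{(i_\eta)_{\eta\ne\mu}\\ 1\le i_\eta\le n_\eta}}\ \sum_{\substack{(\ell_\eta)_{\eta\neq\mu}\\ 1\le\ell_\eta\le r_\eta}}\frac{F_{i_1\dots i_d}}{f^\mu_{i_\mu}}\,(z^d_{i_d})_{\ell_d}\cdots(z^{\mu+1}_{i_{\mu+1}})_{\ell_{\mu+1}}(z^{\mu-1}_{i_{\mu-1}})_{\ell_{\mu-1}}\cdots(z^1_{i_1})_{\ell_1}\,(B_\mu)_{\ell_1\dots\ell_d},$$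 where $B_\mu\in\mathbb{R}^{r_1\times\dots\times r_d}$ is the tensor whose mode-$\mu$ matricization is $\Sigma_\mu B^{(\mu)}$, with $\mathbf{B}=(\Sigma_1^{-1},\dots,\Sigma_d^{-1})\mathbf{C}$.
   Context: For a tensor $\mathbf{A}\in\mathbb{R}^{n_1\times\dots\times n_d}$, the matricization $A^{(\mu)}$ with respect to mode $\mu$ is the matrix with $n_\mu$ rows and $\prod_{\alpha\neq\mu}n_\alpha$ columns whose entry in row $i_\mu$ and column $1+\sum_{\alpha\ne\mu}(i_\alpha-1)m_\alpha$, with $m_\alpha=\prod_{\beta<\alpha,\ \beta\neq\mu}n_\beta$, is $A_{i_1\dots i_d}$. For matrices $M_\mu$ of compatible size, $(M_1,\dots,M_d)\mathbf{A}$ is the tensor-times-matrix product: $(M_1,\dots,M_d)(\mathbf{a}_1\otimes\dots\otimes\mathbf{a}_d)=M_1\mathbf{a}_1\otimes\dots\otimes M_d\mathbf{a}_d$, extended linearly. The inner product induced by symmetric positive definite matrices $M_\mu$ is $\langle\mathbf{A},\mathbf{A}'\rangle=\langle(M_1,\dots,M_d)\mathbf{A},(M_1,\dots,M_d)\mathbf{A}'\rangle$. The mode-$\mu$ marginal $\mathbf{f}^\mu$ is the vector whose $i_\mu$-th component $f^\mu_{i_\mu}$ is the sum of all entries of $\mathbf{F}$ with $\mu$-th index equal to $i_\mu$. The square root in $\operatorname{diag}(\sqrt{\mathbf{f}^\mu})$ is componentwise. Let $\mathbf{X}=(D_1^{-1},\dots,D_d^{-1})\mathbf{F}$, i.e.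 $X_{i_1\dots i_d}=F_{i_1\dots i_d}/\sqrt{f^1_{i_1}\cdots f^d_{i_d}}$. The HOSVD of $\mathbf{X}$ at multilinear rank $(r_1,\dots,r_d)$ consists of matrices $U_\mu\in\mathbb{R}^{n_\mu\times r_\mu}$ whose columns are orthonormal left singular vectors of $X^{(\mu)}$ associated with its $r_\mu$ largest singular values $\sigma^\mu_1\ge\dots\ge\sigma^\mu_{r_\mu}$, together with the core $\mathbf{C}=(U_1^{T},\dots,U_d^{T})\mathbf{X}$. Put $\Sigma_\mu=\operatorname{diag}(\sigma^\mu_1,\dots,\sigma^\mu_{r_\mu})$, $Y_\mu=U_\mu\Sigma_\mu$ (principal components of $\mathbf{X}$), $W_\mu=D_\mu Y_\mu$ (principal components of $\mathbf{F}$ in $\mathcal{S}_M$), and $Z_\mu=D_\mu^{-2}W_\mu$ (scaled principal components of $\mathbf{F}$ in $\mathcal{S}_M$). *)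

(* Defs.v *)
From mathcomp Require Import all_boot all_order all_algebra.
From mathcomp Require Import reals.

Set Implicit Arguments.
Unset Strict Implicit.
Unset Printing Implicit Defensive.

Import Order.TTheory GRing.Theory Num.Theory.

Local Open Scope ring_scope.

Definition mindex (d : nat) (n : 'I_d -> nat) : finType :=
  {dffun forall mu : 'I_d, 'I_(n mu)}.

Definition tensor (R : Type) (d : nat) (n : 'I_d -> nat) : Type :=
  {ffun mindex n -> R}.

(* Indices are 0-based: the column of the entry [I] in the mode-[mu]
   matricization is [\sum_(a != mu) I a * m_a], where [m_a] is the product of
   the [n b] with [b < a] and [b != mu]. *)
Definition colnum d (n : 'I_d -> nat) (mu : 'I_d) (I : mindex n) : nat :=
  (\sum_(a < d | a != mu) I a * \prod_(b < d | (b < a) && (b != mu)) n b)%N.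

Section Columns.
Variables (d : nat) (n : 'I_d -> nat) (mu : 'I_d).

Let pre (k : nat) (a : 'I_d) := (a < k)%N && (a != mu).

Let partial (k : nat) (I : mindex n) : nat :=
  (\sum_(a < d | pre k a) I a * \prod_(b < d | pre a b) n b)%N.

Let partial_rec (k : nat) (lt_kd : (k < d)%N) (I : mindex n) :
  let a := Ordinal lt_kd in
  (partial k.+1 I = (a != mu) * (I a * \prod_(b | pre k b) n b) + partial k I)%N.
Proof.
move=> a; rewrite /partial; have [Ea | neq] := eqVneq a mu.
  rewrite mul0n add0n; apply: eq_bigl => b; rewrite /pre ltnS leq_eqVlt.
  case: eqP => //= Eb; rewrite Eb ltnn /=.
  by apply/negbTE; rewrite negbK -Ea -val_eqE /= Eb.
rewrite mul1n (bigD1 a) /pre ?ltnSn //=; congr (_ + _)%N.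
apply: eq_bigl => b; rewrite ltnS leq_eqVlt -(val_eqE b a) /=.
by case: (ltngtP b k) => //= _; rewrite ?andbT ?andbF.
Qed.

Let prod_rec (k : nat) (lt_kd : (k < d)%N) :
  let a := Ordinal lt_kd in
  (\prod_(b | pre k.+1 b) n b =
     (if a != mu then n a else 1) * \prod_(b | pre k b) n b)%N.
Proof.
move=> a; have [Ea | neq] := eqVneq a mu.
  rewrite mul1n; apply: eq_bigl => b; rewrite /pre ltnS leq_eqVlt.
  case: eqP => //= Eb; rewrite Eb ltnn /=.
  by apply/negbTE; rewrite negbK -Ea -val_eqE /= Eb.
rewrite (bigD1 a) /pre ?ltnSn //=; congr (_ * _)%N.
apply: eq_bigl => b; rewrite ltnS leq_eqVlt -(val_eqE b a) /=.
by case: (ltngtP b k) => //= _; rewrite ?andbT ?andbF.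
Qed.

Let partial_lt (k : nat) (I : mindex n) :
  (k <= d)%N -> (partial k I < \prod_(b | pre k b) n b)%N.
Proof.
elim: k => [_ | k IHk lt_kd]; first by rewrite /partial !big_pred0.
rewrite partial_rec prod_rec; set a := Ordinal lt_kd.
have IH := IHk (ltnW lt_kd).
case: (a != mu); last by rewrite mul0n mul1n.
apply: leq_trans (_ : (I a).+1 * \prod_(b | pre k b) n b <= _)%N.
  by rewrite mul1n mulSnr ltn_add2l.
by rewrite leq_mul2r ltn_ord orbT.
Qed.

Let colnumE (I : mindex n) : colnum mu I = partial d I.
Proof. by apply: eq_bigl => a; rewrite /pre ltn_ord. Qed.

Let prodE : (\prod_(b | pre d b) n b = \prod_(b < d | b != mu) n b)%N.
Proof. by apply: eq_bigl => a; rewrite /pre ltn_ord. Qed.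

Lemma colnum_lt (I : mindex n) :
  (colnum mu I < \prod_(a < d | a != mu) n a)%N.
Proof. by rewrite colnumE -prodE partial_lt. Qed.

Let partial_inj (k : nat) (I J : mindex n) : (k <= d)%N ->
  partial k I = partial k J -> forall a : 'I_d, pre k a -> I a = J a.
Proof.
elim: k => [// | k IHk] lt_kd; rewrite !partial_rec; set a0 := Ordinal lt_kd.
have [ltI ltJ] := (partial_lt I (ltnW lt_kd), partial_lt J (ltnW lt_kd)).
set p := (\prod_(b | pre k b) n b)%N in ltI ltJ *; move=> E.
have p_gt0 : (0 < p)%N by apply: leq_ltn_trans ltI.
have [Ea0 Ek] : (a0 != mu -> I a0 = J a0) /\ partial k I = partial k J.
  move: E; case: (a0 != mu); last by rewrite !mul0n.
  rewrite !mul1n => E; split=> [_ |].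
    apply/val_inj; have := congr1 (divn^~ p) E.
    by rewrite !divnMDl // !divn_small // !addn0.
  by have := congr1 (modn^~ p) E; rewrite !modnMDl !modn_small.
move=> a; rewrite /pre ltnS leq_eqVlt; case/andP=> /orP[/eqP Ea | lt_ak] neq.
  by have Eaa : a = a0 by [apply/val_inj]; rewrite Eaa Ea0 -?Eaa.
by apply: IHk => //; [exact: ltnW | rewrite /pre lt_ak].
Qed.

Definition colidx (I : mindex n) : 'I_(\prod_(a < d | a != mu) n a) :=
  Ordinal (colnum_lt I).

Lemma rowcol_inj : injective (fun I : mindex n => (I mu, colidx I)).
Proof.
move=> I J [Emu E]; apply/ffunP => a.
have [-> // | neq] := eqVneq a mu.
by apply: (@partial_inj d) => //; rewrite ?colnumE // /pre ?ltn_ord // -!colnumE.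
Qed.

Lemma rowcol_bij : bijective (fun I : mindex n => (I mu, colidx I)).
Proof.
apply: inj_card_bij; first exact: rowcol_inj.
rewrite card_prod !card_ord card_dep_ffun foldrE big_map big_enum /=.
under [leqRHS]eq_bigr do rewrite card_ord.
by rewrite [leqRHS](bigD1 mu).
Qed.

End Columns.

(* By [rowcol_bij], each sum has exactly one term. *)
Definition matricize (R : pzRingType) d (n : 'I_d -> nat) (mu : 'I_d)
    (A : tensor R n) : 'M[R]_(n mu, (\prod_(a < d | a != mu) n a)%N) :=
  \matrix_(i, j) \sum_(I : mindex n | (I mu == i) && (colidx mu I == j)) A I.

Lemma matricizeE (R : pzRingType) d (n : 'I_d -> nat) (mu : 'I_d)
    (A : tensor R n) (I : mindex n) :
  matricize mu A (I mu) (colidx mu I) = A I.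
Proof.
rewrite mxE (big_pred1 I) // => J /=.
by rewrite -(inj_eq (@rowcol_inj d n mu)) xpair_eqE.
Qed.

(* Entrywise form of the tensor-times-matrix product [(M_1, ..., M_d) A]; see
   [ttm_outer] and [ttm_linear]. *)
Definition ttm (R : comPzRingType) d (m n : 'I_d -> nat)
    (M : forall mu, 'M[R]_(m mu, n mu)) (A : tensor R n) : tensor R m :=
  [ffun J : mindex m => \sum_(I : mindex n) (\prod_mu M mu (J mu) (I mu)) * A I].

Definition outer (R : comPzRingType) d (n : 'I_d -> nat)
    (a : forall mu, 'cV[R]_(n mu)) : tensor R n :=
  [ffun I : mindex n => \prod_mu a mu (I mu) 0].

Lemma ttm_linear (R : comPzRingType) d (m n : 'I_d -> nat)
    (M : forall mu, 'M[R]_(m mu, n mu)) (c : R) (A A' : tensor R n) :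
  ttm M [ffun I => c * A I + A' I] = [ffun J => c * ttm M A J + ttm M A' J].
Proof.
apply/ffunP => J; rewrite !ffunE mulr_sumr -big_split.
by apply: eq_bigr => I _; rewrite !ffunE mulrDr mulrCA.
Qed.

Lemma ttm_outer (R : comPzRingType) d (m n : 'I_d -> nat)
    (M : forall mu, 'M[R]_(m mu, n mu)) (a : forall mu, 'cV[R]_(n mu)) :
  ttm M (outer a) = outer (fun mu => M mu *m a mu).
Proof.
apply/ffunP => J; rewrite !ffunE.
pose P_ mu : {ffun 'I_(n mu) -> R} := [ffun i => M mu (J mu) i * a mu i 0].
transitivity (\sum_(I : mindex n) \prod_mu P_ mu (I mu)).
  apply: eq_bigr => I _; rewrite ffunE -big_split.
  by apply: eq_bigr => mu _; rewrite ffunE.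
rewrite (reindex (@dffun_of_fprod _ _)); last first.
  exact/onW_bij/dffun_of_fprod_bij.
transitivity (\sum_(t : fprod (fun mu => 'I_(n mu))) \prod_mu P_ mu (t mu)).
  by apply: eq_bigr => t _; apply: eq_bigr => mu _; rewrite !ffunE.
rewrite big_fprod.
rewrite -(bigA_distr_big_dep (fun mu => tagged_with (fun mu => 'I_(n mu)) mu)
            (fun mu => untag 0 (P_ mu))).
apply: eq_bigr => mu _.
rewrite !mxE -(@big_tag _ _ _ _ (fun mu => 'I_(n mu)) (fun mu => P_ mu)).
by apply: eq_bigr => i _; rewrite ffunE.
Qed.

(* [A = P S Q^T] with [P], [Q] orthogonal and [S] rectangular diagonal; the
   singular values of [A] are [s 0 >= ... >= s (minn m n).-1], and the values
   of [s] beyond these are irrelevant. *)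
Definition is_svd (R : realType) (m n : nat) (A : 'M[R]_(m, n))
    (P : 'M[R]_m) (s : nat -> R) (Q : 'M[R]_n) : Prop :=
  [/\ P^T *m P = 1%:M,
      Q^T *m Q = 1%:M,
      forall k, 0 <= s k,
      forall k l, (k <= l)%N -> s l <= s k
    & A = P *m (\matrix_(i, j) if i == j :> nat then s i else 0) *m Q^T].

(* The columns of [U] are orthonormal left singular vectors of [A] associated
   with its [k] largest singular values [sigma 0 0 >= ... >= sigma 0 (k - 1)]. *)
Definition leading_left_svd (R : realType) (m n k : nat) (A : 'M[R]_(m, n))
    (U : 'M[R]_(m, k)) (sigma : 'rV[R]_k) : Prop :=
  exists (P : 'M[R]_m) (s : nat -> R) (Q : 'M[R]_n),
    [/\ is_svd A P s Q,
        (k <= minn m n)%N,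
        forall (i j : 'I_m) (l : 'I_k), j = l :> nat -> U i l = P i j
      & forall l : 'I_k, sigma 0 l = s l].

Definition is_hosvd (R : realType) d (n r : 'I_d -> nat) (X : tensor R n)
    (U : forall mu, 'M[R]_(n mu, r mu)) (sigma : forall mu, 'rV[R]_(r mu))
    (C : tensor R r) : Prop :=
  (forall mu, leading_left_svd (matricize mu X) (U mu) (sigma mu)) /\
  C = ttm (fun mu => (U mu)^T) X.

Definition frequency (R : realType) d (n : 'I_d -> nat)
    (T : tensor nat n) : tensor R n :=
  [ffun I => (T I)%:R / (\sum_J T J)%N%:R].

Definition marginal (R : realType) d (n : 'I_d -> nat) (F : tensor R n)
    (mu : 'I_d) (i : 'I_(n mu)) : R :=
  \sum_(I : mindex n | I mu == i) F I.

Definition Dmx (R : realType) d (n : 'I_d -> nat) (F : tensor R n)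
    (mu : 'I_d) : 'M[R]_(n mu) :=
  diag_mx (\row_i Num.sqrt (marginal F i)).

(* The inner product of S_M is <A, A'> = <M A, M A'> with
   M = (D_1^-1, ..., D_d^-1), so [ttm M] is an isometry from S_M onto the
   Euclidean tensor space; F is analysed in S_M through its Euclidean image. *)
Definition Xtensor (R : realType) d (n : 'I_d -> nat) (F : tensor R n) :
    tensor R n :=
  ttm (fun mu => invmx (Dmx F mu)) F.

Definition principal_comp (R : realType) (n r : nat) (U : 'M[R]_(n, r))
    (sigma : 'rV[R]_r) : 'M[R]_(n, r) :=
  U *m diag_mx sigma.

Definition principal_comp_S (R : realType) (n r : nat) (D : 'M[R]_n)
    (U : 'M[R]_(n, r)) (sigma : 'rV[R]_r) : 'M[R]_(n, r) :=
  D *m principal_comp U sigma.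

Definition scaled_principal_comp_S (R : realType) (n r : nat) (D : 'M[R]_n)
    (U : 'M[R]_(n, r)) (sigma : 'rV[R]_r) : 'M[R]_(n, r) :=
  invmx (D *m D) *m principal_comp_S D U sigma.

(* Main.v *)
Require Import Defs.
From mathcomp Require Import all_boot all_order all_algebra.
From mathcomp Require Import reals.
From mathcomp Require Import ring.

(** Write [g mu i] for the square root of [marginal F i], so that
    [D mu = diag_mx (g mu)] and, entrywise,
    [Z mu i l = U mu i l * sigma mu 0 l / g mu 0 i]; likewise [X I] is [F I]
    divided by the product of the [g eta 0 (I eta)], and [B L] is [C L] divided
    by the product of the [sigma eta 0 (L eta)].  Substituting these in the
    right-hand side, all weights cancel except the factor
    [(sigma mu 0 l * g mu 0 i)^-1]; taken to the other side, it leaves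
[[
  \sum_(I | I mu == i) X I *
    (\sum_(L | L mu == l) (\prod_(eta != mu) U eta (I eta) (L eta)) * C L)
  = sigma mu 0 l ^+ 2 * U mu i l.
]]

    The rank hypothesis makes the HOSVD exact, [X = ttm U C]: scaling the modes
    by invertible diagonal matrices preserves the rank of every matricization
    ([mxrank_matricize_ttm_diag]), hence the columns of [U eta] span the whole
    column space of the mode-[eta] matricization of [X]
    ([leading_left_svd_proj]), and projecting every mode of [X] onto these
    spaces does nothing ([ttm_fixed]).  In the mode-[mu] matricization,
    [X = ttm U C] reads [X^(mu) = U mu *m H], where the entries of [H] are the
    inner sums above ([matricize_ttm]).  Since [U mu] has orthonormal columns,
    [H = (U mu)^T *m X^(mu)], and the sum over [I] is the entry [(i, l)] of
    [X^(mu) *m (X^(mu))^T *m U mu].  The columns of [U mu] are eigenvectors of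
    the Gram matrix [X^(mu) *m (X^(mu))^T] for the squared singular values
    ([leading_left_svd_gram]), which is the claim. *)

Set Implicit Arguments.
Unset Strict Implicit.
Unset Printing Implicit Defensive.

Import Order.TTheory GRing.Theory Num.Theory.

Local Open Scope ring_scope.

(** * Slices of a tensor and its matricizations *)

Definition update d (n : 'I_d -> nat) (I : mindex n) (mu : 'I_d)
    (i : 'I_(n mu)) : mindex n :=
  [ffun eta => dfwith I i eta].

Lemma update_in d (n : 'I_d -> nat) (I : mindex n) (mu : 'I_d) (i : 'I_(n mu)) :
  update I i mu = i.
Proof. by rewrite ffunE dfwith_in. Qed.

Lemma update_out d (n : 'I_d -> nat) (I : mindex n) (mu : 'I_d) (i : 'I_(n mu))
    (eta : 'I_d) : eta != mu -> update I i eta = I eta.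
Proof. by move=> ne; rewrite ffunE dfwith_out // eq_sym. Qed.

(** The column number is a sum over the modes other than [mu], with weights that
    do not involve [mu] either; so [update] moves along a column. *)
Lemma colidx_update d (n : 'I_d -> nat) (I : mindex n) (mu : 'I_d)
    (i : 'I_(n mu)) : colidx mu (update I i) = colidx mu I.
Proof.
apply/val_inj => /=; apply: eq_bigr => a ne.
by rewrite update_out.
Qed.

Lemma matricize_update (R : pzRingType) d (n : 'I_d -> nat) (mu : 'I_d)
    (A : tensor R n) (i : 'I_(n mu)) (I : mindex n) :
  matricize mu A i (colidx mu I) = A (update I i).
Proof. by rewrite -(colidx_update I i) -{1}(update_in I i) matricizeE. Qed.

Lemma rowcol_surj d (n : 'I_d -> nat) (mu : 'I_d) (i : 'I_(n mu)) j :
  exists2 I : mindex n, i = I mu & j = colidx mu I.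
Proof.
have [h _ hK] := @rowcol_bij d n mu.
by exists (h (i, j)); case: (hK (i, j)).
Qed.

(** Turns a sum over a slice, weighted by a function of the remaining indices,
    into the entry of a matrix product. *)
Lemma sum_slice (R : pzRingType) d (n : 'I_d -> nat) (mu : 'I_d)
    (A : tensor R n) (i : 'I_(n mu)) h :
  \sum_(I : mindex n | I mu == i) A I * h (colidx mu I) =
  \sum_j matricize mu A i j * h j.
Proof.
rewrite (partition_big (@colidx d n mu) xpredT) //=.
apply: eq_bigr => j _; rewrite mxE mulr_suml.
by apply: eq_bigr => I /andP[_ /eqP ->].
Qed.

(** * Tensor-times-matrix products *)

(** Exchanging the two sums leaves the sum over [L] of a product over the modes,
    which is the image under [M] of the outer product of columns of [N]; so
    [ttm_outer] already contains the distributivity that is needed. *)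
Lemma ttm_comp (R : comPzRingType) d (p m n : 'I_d -> nat)
    (M : forall mu, 'M[R]_(p mu, m mu)) (N : forall mu, 'M[R]_(m mu, n mu))
    (A : tensor R n) :
  ttm M (ttm N A) = ttm (fun mu => M mu *m N mu) A.
Proof.
apply/ffunP => J; rewrite !ffunE.
under eq_bigr do rewrite ffunE mulr_sumr.
rewrite exchange_big; apply: eq_bigr => I _.
under eq_bigr do rewrite mulrA.
rewrite -mulr_suml; congr (_ * _).
have := congr1 (fun t : tensor R p => t J)
  (ttm_outer M (fun mu => col (I mu) (N mu))).
rewrite !ffunE => E.
transitivity (\prod_mu (M mu *m col (I mu) (N mu)) (J mu) 0).
  rewrite -E; apply: eq_bigr => L _; rewrite ffunE; congr (_ * _).
  by apply: eq_bigr => mu _; rewrite mxE.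
by apply: eq_bigr => mu _; rewrite colE mulmxA -colE mxE.
Qed.

Lemma ttm1 (R : comPzRingType) d (n : 'I_d -> nat) (A : tensor R n) :
  ttm (fun=> 1%:M) A = A.
Proof.
apply/ffunP => J; rewrite ffunE (bigD1 J) //= big1 ?mul1r.
  rewrite big1 ?addr0 // => I neIJ.
  have [mu ne] : exists mu, J mu != I mu.
    apply/existsP; apply: contraR neIJ; rewrite negb_exists => /forallP e.
    by apply/eqP/ffunP => mu; have := e mu; rewrite negbK => /eqP.
  by rewrite (bigD1 mu) //= mxE (negPf ne) !mul0r.
by move=> mu _; rewrite mxE eqxx.
Qed.

Lemma ttm_diag (R : comPzRingType) d (n : 'I_d -> nat)
    (v : forall mu, 'rV[R]_(n mu)) (A : tensor R n) (I : mindex n) :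
  ttm (fun mu => diag_mx (v mu)) A I = (\prod_mu v mu 0 (I mu)) * A I.
Proof.
rewrite -[in RHS](ttm1 A) !ffunE mulr_sumr; apply: eq_bigr => J _.
rewrite mulrA -big_split; congr (_ * _).
by apply: eq_bigr => mu _; rewrite !mxE /= mulr_natr.
Qed.

(** Groups the indices by their mode-[mu] component.  The inner sum depends on
    [J] only through the other modes, so it is the entry at [l] and
    [colidx mu J] of a matrix [H], and the mode-[mu] matricization is
    [M mu *m H]. *)
Lemma matricize_ttm (R : comPzRingType) d (m n : 'I_d -> nat)
    (M : forall mu, 'M[R]_(m mu, n mu)) (A : tensor R n) (mu : 'I_d)
    (i : 'I_(m mu)) (J : mindex m) :
  matricize mu (ttm M A) i (colidx mu J) =
  \sum_l M mu i l *
    \sum_(I : mindex n | I mu == l)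
      (\prod_(eta | eta != mu) M eta (J eta) (I eta)) * A I.
Proof.
rewrite matricize_update ffunE.
rewrite (partition_big (fun I : mindex n => I mu) xpredT) //=.
apply: eq_bigr => l _; rewrite mulr_sumr; apply: eq_bigr => I /eqP <-.
rewrite (bigD1 mu) //= update_in mulrA; congr (_ * _ * _).
by apply: eq_bigr => eta ne; rewrite update_out.
Qed.

(** Acting on one mode at a time reduces a [ttm] by square matrices to ordinary
    matrix products with the matricizations. *)
Definition on_modes (R : pzRingType) d (n : 'I_d -> nat) (s : seq 'I_d)
    (P : forall mu, 'M[R]_(n mu)) (mu : 'I_d) : 'M[R]_(n mu) :=
  if mu \in s then P mu else 1%:M.

Lemma matricize_ttm_on_mode (R : comPzRingType) d (n : 'I_d -> nat)
    (P : forall mu, 'M[R]_(n mu)) (A : tensor R n) (mu : 'I_d) :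
  matricize mu (ttm (on_modes [:: mu] P) A) = P mu *m matricize mu A.
Proof.
apply/matrixP => i j; have [J -> ->] := rowcol_surj i j.
rewrite matricize_ttm mxE; apply: eq_bigr => l _.
rewrite {1}/on_modes mem_head; congr (_ * _).
have := matricize_ttm (fun=> 1%:M) A l J; rewrite ttm1 => ->.
rewrite [RHS](bigD1 l) //= mxE eqxx mul1r [X in _ = _ + X]big1 ?addr0.
  apply: eq_bigr => I _; congr (_ * _); apply: eq_bigr => eta ne.
  by rewrite /on_modes inE (negPf ne).
by move=> k ne; rewrite mxE eq_sym (negPf ne) mul0r.
Qed.

Lemma matricize_inj (R : pzRingType) d (n : 'I_d -> nat) (mu : 'I_d) :
  injective (@matricize R d n mu).
Proof. by move=> A A' E; apply/ffunP => I; rewrite -!(matricizeE mu) E. Qed.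

(** The modes are treated one after the other: by [ttm_comp] the product on the
    modes [mu :: s] is the product on [s] followed by that on [mu], and the
    latter multiplies the mode-[mu] matricization on the left. *)
Lemma ttm_fixed (R : comPzRingType) d (n : 'I_d -> nat)
    (P : forall mu, 'M[R]_(n mu)) (A : tensor R n) :
  (forall mu, P mu *m matricize mu A = matricize mu A) -> ttm P A = A.
Proof.
move=> PA; suff step s : uniq s -> ttm (on_modes s P) A = A.
  rewrite -[RHS](step (enum 'I_d)) ?enum_uniq //.
  apply/ffunP => J; rewrite !ffunE; apply: eq_bigr => I _; congr (_ * _).
  by apply: eq_bigr => mu _; rewrite /on_modes mem_enum.
elim: s => [_ | mu s IHs /andP[mu_s /IHs E]]; first exact: ttm1.
transitivity (ttm (on_modes [:: mu] P) (ttm (on_modes s P) A)).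
  rewrite ttm_comp; apply/ffunP => J; rewrite !ffunE.
  apply: eq_bigr => I _; congr (_ * _); apply: eq_bigr => eta _.
  rewrite /on_modes !inE; have [-> | _] /= := eqVneq eta mu.
    by rewrite (negPf mu_s) mulmx1.
  by rewrite mul1mx.
by rewrite E; apply: (matricize_inj (mu := mu)); rewrite matricize_ttm_on_mode.
Qed.

(** * Invertible diagonal scalings *)

Lemma mulmx_diag_inv (F : fieldType) n (v : 'rV[F]_n) :
  (forall i, v 0 i != 0) -> diag_mx v *m diag_mx (\row_i (v 0 i)^-1) = 1%:M.
Proof.
move=> v0; rewrite mulmx_diag -diag_const_mx; congr diag_mx.
by apply/rowP => i; rewrite !mxE divff.
Qed.

Lemma diag_unitmx (F : fieldType) n (v : 'rV[F]_n) :
  (forall i, v 0 i != 0) -> diag_mx v \in unitmx.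
Proof. by case/mulmx_diag_inv/mulmx1_unit. Qed.

Lemma invmx_diag (F : fieldType) n (v : 'rV[F]_n) :
  (forall i, v 0 i != 0) -> invmx (diag_mx v) = diag_mx (\row_i (v 0 i)^-1).
Proof.
move=> v0; rewrite -[LHS]mulmx1 -(mulmx_diag_inv v0) mulKmx //.
exact: diag_unitmx.
Qed.

Lemma mxrank_unit_mul (F : fieldType) m n (L : 'M[F]_m) (A : 'M[F]_(m, n))
    (K : 'M[F]_n) :
  L \in unitmx -> K \in unitmx -> \rank (L *m A *m K) = \rank A.
Proof.
move=> Lu Ku; rewrite mxrankMfree ?row_free_unit //.
by rewrite eqmxMfull ?row_full_unit.
Qed.

Lemma diag_mul_diagE (R : comPzRingType) m n (v : 'rV[R]_m) (A : 'M[R]_(m, n))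
    (w : 'rV[R]_n) i j :
  (diag_mx v *m A *m diag_mx w) i j = v 0 i * A i j * w 0 j.
Proof. by rewrite mul_mx_diag mul_diag_mx !mxE. Qed.

(** The diagonal scaling acts on a matricization by an invertible diagonal
    matrix on each side.  The right one carries, in each column, the product of
    the factors of the modes other than [mu]. *)
Lemma mxrank_matricize_ttm_diag (F : fieldType) d (n : 'I_d -> nat)
    (v : forall mu, 'rV[F]_(n mu)) (A : tensor F n) (mu : 'I_d) :
    (forall eta i, v eta 0 i != 0) ->
  \rank (matricize mu (ttm (fun eta => diag_mx (v eta)) A)) =
  \rank (matricize mu A).
Proof.
move=> v0; have [i0 _ | no] := pickP 'I_(n mu); last first.
  by congr (\rank _); apply/matrixP => i; have := no i.
(* The entries of [V] do not depend on mode [mu], so all rows of its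
   matricization are equal: row [i0] gives the weights of the columns. *)
pose V : tensor F n :=
  [ffun I : mindex n => \prod_(eta | eta != mu) v eta 0 (I eta)].
pose K := diag_mx (row i0 (matricize mu V)).
have KE I : row i0 (matricize mu V) 0 (colidx mu I) =
    \prod_(eta | eta != mu) v eta 0 (I eta).
  rewrite mxE matricize_update ffunE.
  by apply: eq_bigr => eta ne; rewrite update_out.
rewrite -(@mxrank_unit_mul _ _ _ (diag_mx (v mu)) (matricize mu A) K);
  first last.
- apply: diag_unitmx => j; have [I _ ->] := rowcol_surj i0 j.
  by rewrite KE; apply/prodf_neq0.
- exact: diag_unitmx.
congr (\rank _); apply/matrixP => i j; have [I -> ->] := rowcol_surj i j.
by rewrite diag_mul_diagE KE !matricizeE ttm_diag mulrAC (bigD1 mu).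
Qed.

(** * Singular value decompositions *)

Definition rect_diag (R : pzRingType) m n (s : nat -> R) : 'M[R]_(m, n) :=
  \matrix_(i, j) if i == j :> nat then s i else 0.

Lemma rect_diag_pid (R : comPzRingType) m n (s : nat -> R) k :
    (forall i, (i < minn m n)%N -> (k <= i)%N -> s i = 0) ->
  pid_mx k *m rect_diag m n s = rect_diag m n s.
Proof.
move=> s0; apply/matrixP => i j; rewrite mxE (bigD1 i) //= big1 => [|i' ne].
  rewrite addr0 !mxE eqxx /=; case: ltnP => [_ | le_ki]; first by rewrite mul1r.
  rewrite mul0r; case: eqP => // e; rewrite s0 //.
  by rewrite leq_min ltn_ord e ltn_ord.
by rewrite mxE eq_sym (negPf (ne : i' != i :> nat)) mul0r.
Qed.

Lemma rank_rect_diag (F : fieldType) m n (s : nat -> F) k :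
    (k <= minn m n)%N ->
    (forall i, (i < minn m n)%N -> (s i != 0) = (i < k)%N) ->
  \rank (rect_diag m n s) = k.
Proof.
rewrite leq_min => /andP[le_km le_kn] sk.
(* Beyond the first [k] entries [s] is replaced by ones, which makes [diag_mx u]
   invertible; the product with [pid_mx k] erases them. *)
pose u := \row_(i < m) if (i < k)%N then s i else 1.
have u0 i : u 0 i != 0.
  rewrite mxE; case: ltnP => [lt_ik | _]; last exact: oner_neq0.
  by rewrite sk // leq_min ltn_ord (leq_trans lt_ik).
rewrite -[RHS](@rank_pid_mx F m n k) //.
rewrite -(@mxrank_unit_mul _ _ _ (diag_mx u) (pid_mx k) 1%:M)
  ?unitmx1 ?diag_unitmx //.
congr (\rank _); apply/matrixP => i j; rewrite mulmx1 mul_diag_mx !mxE.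
case: eqP => [e | _] /=; last by rewrite mulr0.
case: ltnP => lt_ik; rewrite ?mulr1 ?mulr0 //.
apply/eqP; apply: contraTT lt_ik; rewrite sk -?ltnNge //.
by rewrite leq_min ltn_ord e ltn_ord.
Qed.

(** The rank is the number of nonzero singular values, and these come first
    since the singular values decrease. *)
Lemma svd_nonzero_iff (R : realType) m n (A : 'M[R]_(m, n)) P s Q :
  is_svd A P s Q ->
  forall i, (i < minn m n)%N -> (s i != 0) = (i < \rank A)%N.
Proof.
case=> PP QQ s_ge0 s_dec ->; rewrite -/(rect_diag m n s).
rewrite mxrank_unit_mul; last 2 first.
- by have [] := mulmx1_unit PP.
- by have [] := mulmx1_unit QQ.
have [k [le_k sk]] : exists k, (k <= minn m n)%N /\
    forall i, (i < minn m n)%N -> (s i != 0) = (i < k)%N.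
  elim: (minn m n) => [|N [k [le_kN sk]]]; first by exists 0%N.
  have [s0 | sN] := eqVneq (s N) 0.
    exists k; split=> [|i]; first exact: leqW.
    rewrite ltnS leq_eqVlt => /orP[/eqP -> | /sk //].
    by rewrite s0 eqxx ltnNge le_kN.
  exists N.+1; split=> // i ltiN; rewrite ltiN; apply: lt0r_neq0.
  by apply: lt_le_trans (s_dec i N ltiN); rewrite lt0r sN s_ge0.
by rewrite (rank_rect_diag le_k sk) => i /sk.
Qed.

(** The matrix [pid_mx k] selects the first [k] columns of [P]. *)
Lemma leading_left_svdP (R : realType) m n k
    (A : 'M[R]_(m, n)) (U : 'M[R]_(m, k)) (sigma : 'rV[R]_k) :
    leading_left_svd A U sigma ->
  exists P s Q,
  [/\ is_svd A P s Q, (k <= minn m n)%N, U = P *m pid_mx k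
    & sigma = \row_(l < k) s l].
Proof.
case=> P [s [Q [svdA le_k defU defs]]].
exists P, s, Q; split=> //; last by apply/rowP => l; rewrite mxE.
apply/matrixP => i l; have ltlm : (l < m)%N.
  by apply: leq_trans (ltn_ord l) (leq_trans le_k (geq_minl _ _)).
rewrite (defU i (Ordinal ltlm)) // mxE (bigD1 (Ordinal ltlm)) //=.
rewrite big1 => [|j ne].
  by rewrite addr0 mxE /= eqxx ltn_ord mulr1.
by rewrite mxE (negPf (ne : j != l :> nat)) mulr0.
Qed.

Lemma leading_left_svd_orthonormal (R : realType) m n k
    (A : 'M[R]_(m, n)) (U : 'M[R]_(m, k)) (sigma : 'rV[R]_k) :
    leading_left_svd A U sigma ->
  U^T *m U = 1%:M.
Proof.
move=> svdU.
have [P [s [Q [[PP _ _ _ _] le_k -> _]]]] := leading_left_svdP svdU.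
rewrite trmx_mul tr_pid_mx mulmxA -(mulmxA (pid_mx k)) PP mulmx1.
by rewrite pid_mx_id ?pid_mx_1 // (leq_trans le_k) ?geq_minl.
Qed.

Lemma leading_left_svd_neq0 (R : realType) m n k
    (A : 'M[R]_(m, n)) (U : 'M[R]_(m, k)) (sigma : 'rV[R]_k) :
    leading_left_svd A U sigma ->
  k = \rank A -> forall l, sigma 0 l != 0.
Proof.
move=> svdU.
have [P [s [Q [svdA le_k _ ->]]]] := leading_left_svdP svdU => rk l.
rewrite mxE (svd_nonzero_iff svdA) -?rk //.
exact: leq_trans (ltn_ord l) le_k.
Qed.

(** When [k] is the rank, the columns of [U] span the column space of [A]:
    [U *m U^T] is [P *m pid_mx k *m P^T], and truncating the singular values
    after the first [k] removes only zeros. *)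
Lemma leading_left_svd_proj (R : realType) m n k
    (A : 'M[R]_(m, n)) (U : 'M[R]_(m, k)) (sigma : 'rV[R]_k) :
    leading_left_svd A U sigma ->
  k = \rank A -> U *m U^T *m A = A.
Proof.
move=> svdU.
have [P [s [Q [svdA le_k -> _]]]] := leading_left_svdP svdU => rk.
have s0 i : (i < minn m n)%N -> (k <= i)%N -> s i = 0.
  move=> lti le_ki; apply/eqP; apply: contraTT le_ki.
  by rewrite (svd_nonzero_iff svdA) // -rk -ltnNge.
have [PP _ _ _ ->] := svdA; rewrite -/(rect_diag m n s).
rewrite trmx_mul tr_pid_mx !mulmxA -(mulmxA _ P^T) PP mulmx1.
rewrite -(mulmxA P (pid_mx k)) pid_mx_id // -(mulmxA P (pid_mx k)).
by rewrite rect_diag_pid.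
Qed.

(** In [A *m A^T = P *m S *m S^T *m P^T] the matrix [S *m S^T] is diagonal, with
    the squared singular values. *)
Lemma leading_left_svd_gram (R : realType) m n k
    (A : 'M[R]_(m, n)) (U : 'M[R]_(m, k)) (sigma : 'rV[R]_k) :
    leading_left_svd A U sigma ->
  forall i l, (A *m A^T *m U) i l = sigma 0 l ^+ 2 * U i l.
Proof.
move=> svdU.
have [P [s [Q [[PP QQ _ _ ->] le_k -> ->]]]] :=
  leading_left_svdP svdU => i l.
rewrite -/(rect_diag m n s) !trmx_mul trmxK !mulmxA.
rewrite -(mulmxA _ Q^T) QQ mulmx1 -(mulmxA _ P^T) PP mulmx1.
have E : rect_diag m n s *m (rect_diag m n s)^T *m pid_mx k =
    pid_mx k *m diag_mx (\row_(l < k) s l ^+ 2).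
  apply/matrixP => a b; rewrite mul_mx_diag !mxE.
  have ltbm : (b < m)%N.
    exact: leq_trans (ltn_ord b) (leq_trans le_k (geq_minl _ _)).
  have ltbn : (b < n)%N.
    exact: leq_trans (ltn_ord b) (leq_trans le_k (geq_minr _ _)).
  rewrite (bigD1 (Ordinal ltbm)) //= big1 => [|c ne]; last first.
    by rewrite [pid_mx _ _ _]mxE (negPf (ne : c != b :> nat)) mulr0.
  rewrite !mxE /= eqxx ltn_ord addr0 mulr1 (bigD1 (Ordinal ltbn)) //=.
  rewrite big1 => [|c ne].
    rewrite !mxE /= eqxx addr0; case: eqP => [-> | _] /=; last first.
      by rewrite !mul0r.
    by rewrite ltn_ord mul1r expr2.
  by rewrite !mxE (eq_sym (b : nat)) (negPf (ne : c != b :> nat)) mulr0.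
by rewrite -!mulmxA (mulmxA (rect_diag _ _ _)) E mulmxA mul_mx_diag !mxE mulrC.
Qed.

(** * The barycentric relation *)

Lemma scaled_principal_comp_diag (R : realType) n k (g : 'rV[R]_n)
    (U : 'M[R]_(n, k)) (sigma : 'rV[R]_k) i l :
    (forall j, g 0 j != 0) ->
  scaled_principal_comp_S (diag_mx g) U sigma i l = U i l * sigma 0 l / g 0 i.
Proof.
move=> g0; rewrite /scaled_principal_comp_S /principal_comp_S /principal_comp.
rewrite mulmx_diag invmx_diag => [|j]; last by rewrite mxE mulf_neq0.
rewrite !mulmxA mulmx_diag diag_mul_diagE !mxE.
by field.
Qed.

Theorem proposition6 (R : realType) (d : nat) (n r : 'I_d -> nat)
    (T : tensor nat n)
    (U : forall mu, 'M[R]_(n mu, r mu)) (sigma : forall mu, 'rV[R]_(r mu))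
    (C : tensor R r) (Bm : forall mu : 'I_d, tensor R r) :
  let F := frequency R T in
  let D := Dmx F in
  let Z mu := scaled_principal_comp_S (D mu) (U mu) (sigma mu) in
  let Sigma mu := diag_mx (sigma mu) in
  let B := ttm (fun mu => invmx (Sigma mu)) C in
  (2 <= d)%N ->
  (exists I, T I != 0%N) ->
  (forall (mu : 'I_d) (i : 'I_(n mu)), marginal F i != 0) ->
  is_hosvd (Xtensor F) U sigma C ->
  (forall mu, r mu = \rank (matricize mu F)) ->
  (forall mu, matricize mu (Bm mu) = Sigma mu *m matricize mu B) ->
  forall (mu : 'I_d) (i : 'I_(n mu)) (l : 'I_(r mu)),
    Z mu i l =
      (sigma mu 0 l)^-1 *
      \sum_(I : mindex n | I mu == i) \sum_(L : mindex r | L mu == l)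
        F I / marginal F i *
        (\prod_(eta | eta != mu) Z eta (I eta) (L eta)) * Bm mu L.
Proof.
move=> F D Z Sigma B _ _ f0 [svdU defC] rk defBm mu i l.
pose g eta := \row_(j < n eta) Num.sqrt (marginal F j).
have f_gt0 eta (j : 'I_(n eta)) : 0 < marginal F j.
  rewrite lt0r f0 sumr_ge0 // => I _.
  by rewrite ffunE divr_ge0 ?ler0n.
have g0 eta j : g eta 0 j != 0 by rewrite mxE lt0r_neq0 // sqrtr_gt0.
have gg eta j : g eta 0 j * g eta 0 j = marginal F j.
  by rewrite mxE -expr2 sqr_sqrtr // ltW.
set X := Xtensor F in svdU defC.
have defX : X = ttm (fun eta => diag_mx (\row_j (g eta 0 j)^-1)) F.
  apply/ffunP => J; rewrite !ffunE; apply: eq_bigr => I _; congr (_ * _).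
  by apply: eq_bigr => eta _; rewrite -invmx_diag.
have XE I : X I = (\prod_eta (g eta 0 (I eta))^-1) * F I.
  by rewrite defX ttm_diag; congr (_ * _); apply: eq_bigr => eta _; rewrite mxE.
have rkX eta : r eta = \rank (matricize eta X).
  rewrite rk defX mxrank_matricize_ttm_diag // => mu' j.
  by rewrite mxE invr_neq0.
have sigma0 eta l' : sigma eta 0 l' != 0.
  exact: leading_left_svd_neq0 (svdU eta) (rkX eta) l'.
have BmE L : Bm mu L =
    sigma mu 0 (L mu) * ((\prod_eta (sigma eta 0 (L eta))^-1) * C L).
  rewrite -(matricizeE mu) defBm mul_diag_mx mxE matricizeE; congr (_ * _).
  transitivity (ttm (fun eta => diag_mx (\row_j (sigma eta 0 j)^-1)) C L).
    rewrite !ffunE; apply: eq_bigr => I _; congr (_ * _).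
    by apply: eq_bigr => eta _; rewrite -invmx_diag.
  by rewrite ttm_diag; congr (_ * _); apply: eq_bigr => eta _; rewrite mxE.
have XUC : X = ttm U C.
  rewrite defC ttm_comp ttm_fixed // => eta.
  exact: leading_left_svd_proj (svdU eta) (rkX eta).
pose G := (U mu)^T *m matricize mu X.
(* [X^(mu) = U mu *m H] gives [G = (U mu)^T *m U mu *m H = H]. *)
have GE I : G l (colidx mu I) = \sum_(L : mindex r | L mu == l)
    (\prod_(eta | eta != mu) U eta (I eta) (L eta)) * C L.
  pose H := \col_l' \sum_(L : mindex r | L mu == l')
    (\prod_(eta | eta != mu) U eta (I eta) (L eta)) * C L.
  suff: (U mu)^T *m (U mu *m H) = H.
    move/colP/(_ l); rewrite [RHS]mxE => <-; rewrite !mxE.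
    apply: eq_bigr => k _; congr (_ * _); rewrite XUC matricize_ttm mxE.
    by apply: eq_bigr => l' _; rewrite mxE.
  by rewrite mulmxA (leading_left_svd_orthonormal (svdU mu)) mul1mx.
have gram : \sum_(I : mindex n | I mu == i) X I * G l (colidx mu I) =
    sigma mu 0 l ^+ 2 * U mu i l.
  rewrite sum_slice -(leading_left_svd_gram (svdU mu)) -mulmxA mxE.
  apply: eq_bigr => j _; congr (_ * _).
  have := trmx_mul (matricize mu X)^T (U mu).
  by rewrite trmxK -/G => <-; rewrite mxE.
have ZE eta j k : Z eta j k = U eta j k * sigma eta 0 k / g eta 0 j.
  exact: scaled_principal_comp_diag (g0 eta).
rewrite ZE.
transitivity
  ((sigma mu 0 l)^-1 * ((g mu 0 i)^-1 * (sigma mu 0 l ^+ 2 * U mu i l))).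
  by field; rewrite sigma0 g0.
rewrite -gram mulr_sumr; congr (_ * _); apply: eq_bigr => I /eqP eqIi.
rewrite GE !mulr_sumr; apply: eq_bigr => L /eqP eqLl.
pose PU := \prod_(eta | eta != mu) U eta (I eta) (L eta).
pose Ps := \prod_(eta | eta != mu) sigma eta 0 (L eta).
pose Pg := \prod_(eta | eta != mu) (g eta 0 (I eta))^-1.
have -> : \prod_(eta | eta != mu) Z eta (I eta) (L eta) = PU * Ps * Pg.
  by rewrite -!big_split; apply: eq_bigr => eta _; rewrite ZE.
have Eg : \prod_eta (g eta 0 (I eta))^-1 = (g mu 0 i)^-1 * Pg.
  by rewrite (bigD1 mu) //= eqIi.
have Es : \prod_eta (sigma eta 0 (L eta))^-1 = (sigma mu 0 l)^-1 * Ps^-1.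
  by rewrite (bigD1 mu) //= eqLl prodfV.
have Ps0 : Ps != 0 by apply/prodf_neq0.
rewrite XE BmE -gg eqLl Eg Es -/PU.
by field; rewrite Ps0 sigma0 g0.
Qed.
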